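(* Let $(\mathcal{G},\ell)$ be a labelled graph with $k$ connected components, with $\mathcal{G}=(V,E)$ and $E=R\cup D$, and let $q$ be an admissible positive integer, i.e. $\ell(e)$ divides $q$ for all $e\in E$. Let $M_{\mathcal{G},\ell}(x,y)$ be the arithmetic Tutte polynomial associated to $(\mathcal{G},\ell)$. Then the number $\chi^*_{\mathcal{G},\ell}(q)$ of arithmetic (nowhere zero) $q$-flows of $(\mathcal{G},\ell)$ is $$\chi^*_{\mathcal{G},\ell}(q)=(-1)^{|R|-|\overline{V}|+k}\,q^{|D|-|V|+|\overline{V}|}\,M_{\mathcal{G},\ell}(0,1-q).$$
   Context: **Labelled graphs.** A graph $\mathcal{G}=(V,E)$ consists of a finite set $V$ of vertices and a finite multiset $E$ of edges, each edge being a 2-element multiset of vertices; parallel edges are allowed (and regarded as distinct edges), and graphs are assumed to have no loops. The edges are of two kinds: $E$ is a disjoint union $E=R\cup D$, where elements of $R$ are called regular edges and elements of $D$ dotted edges. A labelled graph is a pair $(\mathcal{G},\ell)$ with $\mathcal{G}$ such a graph and $\ell:E\to\{1,2,3,\dots\}$ a map. Connected components of $\mathcal{G}$ are taken with respect to all edges in $E=R\cup D$. The classical contraction of an edge is the removal of that edge and the identification of its two endpoints. $\overline{\mathcal{G}}=(\overline{V},\overline{E})$ denotes the graph (possibly with loops) obtained from $\mathcal{G}$ by classically contracting all edges in $D$; so $|\overline{V}|$ is the number of connected components of $(V,D)$. **Arithmetic flows.** Fix an orientation of the edges, i.e. replace each edge by an ordered pair of its endpoints; for an oriented edge $e$ let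 $e^+$ and $e^-$ be its first and second coordinates. An arithmetic (nowhere zero) $q$-flow is a function $w:E\to\mathbb{Z}/q\mathbb{Z}$ such that (1) for every $v\in V$, $\sum_{e:\,e^+=v}\ell(e)w(e)-\sum_{e:\,e^-=v}\ell(e)w(e)=0$ in $\mathbb{Z}/q\mathbb{Z}$; (2) $w(e)\neq 0$ for every regular edge $e\in R$. $\chi^*_{\mathcal{G},\ell}(q)$ denotes the number of these; it does not depend on the orientation. **Arithmetic Tutte polynomial of a labelled graph.** Enumerate $V=\{v_1,\dots,v_n\}$ and fix an orientation of the edges. To an edge $e$ oriented as $(v_i,v_j)$ associate the vector $x_e\in\mathbb{Z}^n$ with $i$-th coordinate $\ell(e)$, $j$-th coordinate $-\ell(e)$ and all other coordinates $0$. Let $X_D=\{x_e: e\in D\}$, $G=\mathbb{Z}^n/\langle X_D\rangle$, and for $e\in R$ let $\overline{x_e}$ be the class of $x_e$ in $G$. For $A\subseteq R$ let $\langle A\rangle$ be the subgroup of $G$ generated by $\{\overline{x_e}:e\in A\}$; let $rk(A)$ be the maximal rank of a free abelian subgroup of $\langle A\rangle$; let $G_A$ be the maximal subgroup of $G$ containing $\langle A\rangle$ with finite index; and let $m(A)=|G_A:\langle A\rangle|$. Then $$M_{\mathcal{G},\ell}(x,y)=\sum_{A\subseteq R}m(A)(x-1)^{rk(R)-rk(A)}(y-1)^{|A|-rk(A)},$$ which does not depend on the chosen orientation. *)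

(* Defs.v *)
From HB Require Import structures.
From mathcomp Require Import all_boot all_order all_algebra.
From mathcomp Require Import finmap.
From mathcomp Require Import mathcomp_extra boolp classical_sets cardinality.

Set Implicit Arguments.
Unset Strict Implicit.
Unset Printing Implicit Defensive.

Import Order.TTheory GRing.Theory Num.Theory.
Local Open Scope ring_scope.

Section Subgroups.
Variable G : zmodType.
Implicit Types H K F S : set G.

Definition subgroup H : Prop := H 0 /\ forall x y, H x -> H y -> H (x - y).

Definition generated S : set G := smallest subgroup S.

(* The same subgroup as a boolean predicate, the form that Quotient.quot expects. *)
Definition generated_pred S : {pred G} := fun x => `[< generated S x >].

Fact generated_pred_zmod_closed S : zmod_closed (generated_pred S).
Proof.
split=> [|x y /asboolP Hx /asboolP Hy]; apply/asboolP=> H [subH SH].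
  by case: subH.
by case: (subH) => _; apply; [apply: Hx | apply: Hy].
Qed.

HB.instance Definition _ S :=
  GRing.isZmodClosed.Build G (generated_pred S) (generated_pred_zmod_closed S).

(* F has a basis with r elements. *)
Definition free_abelian F (r : nat) : Prop :=
  exists b : 'I_r -> G,
    let comb (c : {ffun 'I_r -> int}) := \sum_i b i *~ c i in
    injective comb /\ F = range comb.

(* When there is no such r (which cannot happen if H is finitely generated),
   the value is 0. *)
Definition max_free_rank H : nat :=
  xget 0%N [set r : nat |
    (exists F, [/\ subgroup F, (F `<=` H)%classic & free_abelian F r]) /\
    (forall F s, subgroup F -> (F `<=` H)%classic -> free_abelian F s ->
       (s <= r)%N)]%classic.

Definition cosets K H : set (set G) :=
  [set [set y | H (y - x)] | x in K]%classic.

Definition finite_index K H : Prop := finite_set (cosets K H).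

Definition subgroup_index K H : nat := #|` fset_set (cosets K H)|%fset.

(* "K contains H with finite index" bounds the index of H in K. *)
Definition finite_overgroup H K : Prop :=
  [/\ subgroup K, (H `<=` K)%classic & finite_index K H].

(* Such a K exists and is unique when G is finitely generated. *)
Definition max_finite_overgroup H : set G :=
  xget set0 [set K | finite_overgroup H K /\
    (forall K', finite_overgroup H K' -> (K' `<=` K)%classic)]%classic.

End Subgroups.

Section ArithmeticTutte.
Variables (G : zmodType) (I : finType) (x : I -> G).
Implicit Types A : {set I}.

Definition span_of A : set G := generated (x @` [set` A])%classic.

Definition rk A : nat := max_free_rank (span_of A).

Definition mult A : nat :=
  subgroup_index (max_finite_overgroup (span_of A)) (span_of A).

(* The truncated subtractions are exact: rk is monotone and rk A <= #|A|. *)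
Definition arith_tutte (S : {set I}) : {poly {poly int}} :=
  \sum_(A : {set I} | A \subset S)
    (mult A)%:R * ('X - 1) ^+ (rk S - rk A) * ('Y - 1) ^+ (#|A| - rk A).

End ArithmeticTutte.

(* Edges form a type of their own, so parallel edges are allowed; two distinct
   end points are required, so there are no loops. *)
Record multigraph := Multigraph {
  vertex : finType;
  edge : finType;
  ends : edge -> {set vertex};
  card_ends : forall e, #|ends e| = 2%N;
  regular : {set edge}
}.

Definition dotted (g : multigraph) : {set edge g} := ~: regular g.
Arguments regular : clear implicits.
Arguments dotted : clear implicits.

Record labelled_graph := LabelledGraph {
  graph_of :> multigraph;
  label : edge graph_of -> nat;
  label_gt0 : forall e, (0 < label e)%N
}.

Section Graphs.
Variable g : multigraph.

Definition adjacent (S : {set edge g}) : rel (vertex g) :=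
  fun u v => [exists e in S, ends e == [set u; v]].

Definition components (S : {set edge g}) : {set {set vertex g}} :=
  equivalence_partition (connect (adjacent S)) [set: vertex g].

(* The vertices of the graph obtained by contracting all dotted edges. *)
Definition contracted_vertices : {set {set vertex g}} := components (dotted g).

Definition is_orientation (o : edge g -> vertex g * vertex g) : Prop :=
  forall e, [set (o e).1; (o e).2] = ends e.

End Graphs.

Section LabelledGraphs.
Variables (g : labelled_graph) (o : edge g -> vertex g * vertex g).

(* Z/qZ is 'I_q.-1.+1 rather than 'Z_q, since 'Z_1 is Z/2Z. *)
Definition is_nz_flow (q : nat) (w : {ffun edge g -> 'I_q.-1.+1}) : bool :=
  [forall v : vertex g,
     \sum_(e | (o e).1 == v) w e *+ label e
       - \sum_(e | (o e).2 == v) w e *+ label e == 0]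
  && [forall e in regular g, w e != 0].

Definition nb_nz_flows (q : nat) : nat :=
  #|[set w : {ffun edge g -> 'I_q.-1.+1} | is_nz_flow w]|.

Definition edge_vector (e : edge g) : {ffun vertex g -> int} :=
  [ffun v => if v == (o e).1 then (label e)%:Z
             else if v == (o e).2 then - (label e)%:Z else 0].

Definition dotted_vectors : set {ffun vertex g -> int} :=
  (edge_vector @` [set` dotted g])%classic.

Definition graph_group : zmodType :=
  Quotient.quot (generated_pred dotted_vectors).

Definition edge_class (e : edge g) : graph_group :=
  (\pi_(Quotient.quot (generated_pred dotted_vectors)) (edge_vector e))%qT.

Definition graph_arith_tutte : {poly {poly int}} :=
  arith_tutte edge_class (regular g).

End LabelledGraphs.

(* Main.v *)
From HB Require Import structures.
Require Import Defs.
From mathcomp Require Import all_boot all_order all_algebra.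
From mathcomp Require Import finmap.
From mathcomp Require Import boolp classical_sets cardinality.
From mathcomp Require Import zify ring.

(** Write S = A :|: D for a set A of regular edges, D the dotted ones, H(S) for
the lattice spanned in Z^V by the edge vectors of S, and L(S) for the vectors
whose coordinates sum to 0 on every component of (V, S). An edge vector is
l(e) (e_u - e_v) with l(e) | q, and L(S) is spanned by the differences e_u - e_v
of the end points of edges of S; hence q L(S) <= H(S) <= L(S). As
L(S) is saturated of corank c(S), the number of components of (V, S), the
quotient L(S) / H(S) is the torsion subgroup of Z^V / H(S). This settles both
ingredients of the Tutte polynomial:
- the multiplicity of A is the index [L(S) : H(S)]
  ([max_finite_overgroup_span], [mult_balanced]);
- the rank of A is that of L(S) / L(D), namely c(D) - c(S) ([rk_components]).

Since q L(S) <= H(S), the index can be computed modulo q. In (Z/q)^V the image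
of L(S) is the set of balanced vectors, of cardinal q^(|V| - c(S))
([card_ker_pushforward]); the image of H(S) is that of the boundary map
(Z/q)^S -> (Z/q)^V, whose kernel consists of the flows that vanish outside S.
Therefore the number N(S) of these flows satisfies
  N(S) q^|V| = q^|S| q^c(S) m(A)
([card_flows]). A flow is nowhere zero when it vanishes at no regular edge, and
inclusion-exclusion over the regular edges where it vanishes ([sieve]) gives
the alternating sum over A of the N(A :|: D). With the values of the ranks
above, this is the evaluation at (0, 1 - q) of the Tutte polynomial, term by
term ([flow_term_eq]).

Component sums are handled by a map r that sends every vertex to a
representative of its component: the pushforward of z along r has at each
representative the sum of z over its component, and 0 elsewhere. So L(S) is
the kernel of the pushforward, and everything is done with this one additive
map. *)

Set Implicit Arguments.
Unset Strict Implicit.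
Unset Printing Implicit Defensive.

Import Order.TTheory GRing.Theory Num.Theory.
Local Open Scope ring_scope.

(** * Subgroups, indices and free ranks *)

Section SubgroupTheory.
Variable G : zmodType.
Implicit Types (H K : set G) (x y : G).

Lemma subgroupN H x : subgroup H -> H x -> H (- x).
Proof. by case=> H0 HB Hx; rewrite -sub0r; apply: HB. Qed.

Lemma subgroupD H x y : subgroup H -> H x -> H y -> H (x + y).
Proof.
move=> sH Hx Hy; rewrite -[y]opprK; apply: sH.2 => //.
exact: subgroupN.
Qed.

Lemma subgroup_sum H (I : finType) (P : pred I) (F : I -> G) :
  subgroup H -> (forall i, P i -> H (F i)) -> H (\sum_(i | P i) F i).
Proof.
move=> sH HF; apply: big_ind => //; first exact: sH.1.
by move=> *; apply: subgroupD.
Qed.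

Lemma subgroupMz H x n : subgroup H -> H x -> H (x *~ n).
Proof.
move=> sH Hx.
have HMn m : H (x *+ m).
  by elim: m => [|m IH]; [apply: sH.1 | rewrite mulrS; apply: subgroupD].
by case: n => n; [exact: HMn | apply: subgroupN => //; exact: HMn].
Qed.

Lemma generated_subgroup (S : set G) : subgroup (generated S).
Proof.
split=> [|x y Hx Hy] K [sK SK]; first exact: sK.1.
by apply: sK.2; [apply: Hx | apply: Hy].
Qed.

Lemma span_ofP (I : finType) (x : I -> G) (A : {set I}) y :
  span_of x A y <-> exists c : {ffun I -> int}, y = \sum_(e in A) x e *~ c e.
Proof.
split=> [yA|[c ->]]; last first.
  have sS : subgroup (span_of x A) := generated_subgroup _.
  apply: (subgroup_sum sS) => e eA; apply: (subgroupMz _ sS).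
  by move=> K [_]; apply; exists e.
apply: (yA [set z | exists c : {ffun I -> int},
  z = \sum_(e in A) x e *~ c e]%classic).
split=> [|_ [e eA <-]].
  split=> [|_ _ [c ->] [d ->]].
    by exists 0; rewrite big1 // => e _; rewrite ffunE mulr0z.
  exists (c - d); rewrite -sumrB; apply: eq_bigr => e _.
  by rewrite !ffunE mulrzBr.
exists [ffun i => (i == e)%:Z]; rewrite (bigD1 e) //= ffunE eqxx.
by rewrite big1 ?addr0 // => i /andP[_ /negPf ie]; rewrite ffunE ie.
Qed.

(** An index is computed by any map that takes different values exactly on
different cosets. The conclusion includes finiteness, so that the same map also
shows that K is a finite overgroup of H. *)
Lemma subgroup_indexE (T : finType) (f : G -> T) (K H : set G) (B : {set T}) :
  subgroup H -> (forall x, K x -> f x \in B) ->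
  (forall b, b \in B -> exists2 x, K x & f x = b) ->
  (forall x y, K x -> K y -> f x = f y <-> H (y - x)) ->
  finite_index K H /\ subgroup_index K H = #|B|.
Proof.
move=> sH KB BK fH.
pose c b := [set y | exists2 x, K x /\ f x = b & H (y - x)]%classic.
have cE x : K x -> c (f x) = [set y | H (y - x)]%classic.
  move=> Kx; apply/seteqP; split=> y /=; last by exists x.
  case=> x' [Kx' fx'] Hy.
  by rewrite -[y](subrK x') -addrA; apply: subgroupD => //; apply/fH.
have c_inj : {in B &, injective c}.
  move=> _ _ /BK[x Kx <-] /BK[y Ky <-]; rewrite !cE // => e.
  apply/fH => //; move: (sH.1).
  by rewrite -(subrr y) -[H _]/([set z | H (z - y)]%classic y) -e.
have cosetsE : cosets K H = [set` [fset c b | b in B]%fset]%classic.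
  apply/seteqP; split=> [_ [x Kx <-]|_ /imfsetP[_ /BK[x Kx <-] ->]] /=.
    by rewrite -cE //; apply/imfsetP; exists (f x) => //; apply: KB.
  by exists x => //; rewrite cE.
rewrite /finite_index /subgroup_index cosetsE; split; first exact: finite_fset.
by rewrite set_fsetK card_in_imfset //= cardE.
Qed.

End SubgroupTheory.

(** Two of the multiples of x lie in the same coset, by the pigeonhole
principle. *)
Lemma finite_index_torsion (G : zmodType) (K H : set G) x :
  subgroup K -> subgroup H -> finite_index K H -> K x ->
  exists2 n, (0 < n)%N & H (x *+ n).
Proof.
move=> sK sH finKH Kx; apply: contrapT => noH.
pose f n := [set y | H (y - x *+ n)]%classic.
suff : finite_set (f @^-1` cosets K H)%classic.
  suff -> : (f @^-1` cosets K H = [set: nat])%classic by exact: infinite_nat.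
  apply/seteqP; split=> // n _; exists (x *+ n) => //.
  exact: (subgroupMz n%:Z sK Kx).
apply: finite_preimage => // m n _ _ fmn; apply: contrapT => /eqP neq_mn.
wlog lt_mn : m n fmn neq_mn / (m < n)%N.
  move=> W; case: (ltngtP m n) neq_mn => // mn _.
    by apply: (W m n); rewrite // ltn_eqF.
  by apply: (W n m); rewrite // ltn_eqF.
apply: noH; exists (n - m)%N; first by rewrite subn_gt0.
have : f n (x *+ n) by rewrite /f /= subrr; exact: sH.1.
rewrite mulrnBr 1?ltnW //.
by rewrite -fmn.
Qed.

(** In Smith normal form M = L D R, row t of D is zero because D has only t
columns, so row t of L^-1 is in the kernel. *)
Lemma int_kernel s t (M : 'M[int]_(s, t)) :
  (t < s)%N -> exists2 u : 'rV_s, u != 0 & u *m M = 0.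
Proof.
move=> ts; have [L uL [R _ [d _ ->]]] := int_Smith_normal_form M.
exists (delta_mx 0 (Ordinal ts) *m invmx L).
  apply/eqP => /(congr1 (mulmx^~ L)); rewrite mulmxKV // mul0mx.
  by move/matrixP/(_ 0 (Ordinal ts)); rewrite !mxE !eqxx.
rewrite !mulmxA mulmxKV // -rowE (_ : row _ _ = 0) ?mul0mx //.
by apply/rowP=> j; rewrite !mxE /= gtn_eqF.
Qed.

Lemma max_free_rankE (G : zmodType) (H F : set G) r :
  subgroup F -> (F `<=` H)%classic -> free_abelian F r ->
  (forall F s, subgroup F -> (F `<=` H)%classic -> free_abelian F s ->
    (s <= r)%N) ->
  max_free_rank H = r.
Proof.
move=> sF FH freeF r_max.
apply: xget_unique => [|s [[F' [sF' F'H freeF']] s_max]].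
  by split=> //; exists F.
by apply/eqP; rewrite eqn_leq (r_max F') // (s_max F).
Qed.

Lemma range_comb_subgroup (G : zmodType) r (b : 'I_r -> G) :
  subgroup (range (fun c : {ffun 'I_r -> int} => \sum_i b i *~ c i)).
Proof.
split=> [|_ _ [c _ <-] [d _ <-]].
  by exists 0 => //; rewrite big1 // => i _; rewrite ffunE mulr0z.
exists (c - d) => //; rewrite -sumrB; apply: eq_bigr => i _.
by rewrite !ffunE mulrzBr.
Qed.

(** More than #|A| combinations of #|A| generators satisfy an integral relation,
so they are not a basis. The bound makes the exponent #|A| - rk A of the Tutte
polynomial an exact difference. *)
Lemma rk_le_card (G : zmodType) (I : finType) (x : I -> G) (A : {set I}) :
  (rk x A <= #|A|)%N.
Proof.
rewrite /rk /max_free_rank.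
case: xgetP => [r _ [[F [_ FA [b [b_free FE]]]] _]|] //.
have /choice[c cE] :
    forall i, exists c : {ffun I -> int}, b i = \sum_(e in A) x e *~ c e.
  move=> i; apply/span_ofP; apply: (FA (b i)); rewrite FE.
  exists [ffun j => (j == i)%:Z] => //.
  rewrite (bigD1 i) //= ffunE eqxx big1 ?addr0 // => j /negPf ji.
  by rewrite ffunE ji.
rewrite leqNgt; apply/negP => Ar.
pose M : 'M[int]_(r, #|A|) := \matrix_(i, j) c i (enum_val j).
have [u /eqP u0 uM] := int_kernel M Ar.
have /b_free/ffunP ub : \sum_i b i *~ [ffun i => u 0 i] i =
    \sum_i b i *~ (0 : {ffun _ -> int}) i.
  rewrite [RHS]big1 => [|i _]; last by rewrite ffunE mulr0z.
  under eq_bigr => i _ do rewrite cE mulrz_suml.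
  rewrite exchange_big big1 //= => e eA.
  rewrite (eq_bigr (fun i => x e *~ (c i e * u 0 i))); last first.
    by move=> i _; rewrite ffunE mulrzA.
  rewrite -mulrz_sumr (_ : \sum_i _ = 0) ?mulr0z //.
  move/rowP/(_ (enum_rank_in eA e)): uM; rewrite !mxE => ue.
  by rewrite -[RHS]ue; apply: eq_bigr => i _;
    rewrite mxE enum_rankK_in // mulrC.
by apply: u0; apply/rowP=> i; have := ub i; rewrite !ffunE mxE.
Qed.

(** * Counting by fibres *)

Lemma card_fibers (T U : finType) (f : T -> U) (A : {set T}) n :
  {in A, forall x, #|[set y in A | f y == f x]| = n} ->
  #|A| = (#|f @: A| * n)%N.
Proof.
move=> fibn; rewrite -sum1_card (partition_big_imset f) /=.
rewrite -sum_nat_const; apply: eq_bigr => _ /imsetP[x xA ->].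
by rewrite -(fibn x xA) sum1_card cardsE.
Qed.

Section Vectors.
Variables (V : finType) (C : finZmodType).
Implicit Types A K : {set {ffun V -> C}}.

(** When the fibres of f in A are translates of K. Used with K the kernel of an
additive map, and with f the map from vectors to their cosets modulo K. *)
Lemma card_translates (U : finType) (f : {ffun V -> C} -> U) A K :
  {in A & K, forall x y, x + y \in A} ->
  {in A &, forall x y, (f y == f x) = (y - x \in K)} ->
  #|A| = (#|f @: A| * #|K|)%N.
Proof.
move=> AK fK; apply: card_fibers => x xA.
rewrite -(card_imset K (addrI x)); apply: eq_card => y; rewrite inE.
apply/andP/imsetP=> [[yA]|[z zK ->]].
  by rewrite fK // => yK; exists (y - x); rewrite // addrC subrK.
by rewrite fK ?AK // addrC addKr.
Qed.
End Vectors.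

(** * Pushforward of vectors along a map of the index set *)

Section Pushforward.
Variable V : finType.
Implicit Types r : V -> V.

Definition pushforward (C : zmodType) r (z : {ffun V -> C}) : {ffun V -> C} :=
  [ffun u => \sum_(v | r v == u) z v].

Fact pushforward_is_zmod_morphism (C : zmodType) r :
  zmod_morphism (@pushforward C r).
Proof.
move=> z z'; apply/ffunP=> u; rewrite !ffunE -sumrB.
by apply: eq_bigr => v _; rewrite !ffunE.
Qed.

HB.instance Definition _ (C : zmodType) r :=
  GRing.isZmodMorphism.Build {ffun V -> C} {ffun V -> C} (@pushforward C r)
    (pushforward_is_zmod_morphism r).

Lemma pushforward_comp (C : zmodType) r r' (z : {ffun V -> C}) :
  pushforward r (pushforward r' z) = pushforward (r \o r') z.
Proof.
apply/ffunP=> u; rewrite !ffunE.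
rewrite [RHS](partition_big r' (fun v => r v == u)) //=.
apply: eq_bigr => v /eqP rv; rewrite ffunE; apply: eq_bigl => w.
by apply/eqP/andP=> [r'w|[_ /eqP]//]; rewrite /= r'w rv !eqxx.
Qed.

Definition indicator u : {ffun V -> int} := [ffun v => (v == u)%:Z].

Lemma indicator_sum (z : {ffun V -> int}) : z = \sum_v indicator v *~ z v.
Proof.
apply/ffunP=> u; rewrite sum_ffunE (bigD1 u) //= ffunMzE ffunE eqxx.
rewrite big1 ?addr0 ?intz // => v /negPf vu.
by rewrite ffunMzE ffunE eq_sym vu mul0rz.
Qed.

Lemma pushforward_indicator r u : pushforward r (indicator u) = indicator (r u).
Proof.
apply/ffunP=> v; rewrite !ffunE.
have [->|ruv] := eqVneq v (r u).
  rewrite (bigD1 u) //= ffunE eqxx big1 // => w /andP[_ /negPf wu].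
  by rewrite ffunE wu.
rewrite big1 // => w /eqP rw; rewrite ffunE.
by case: (eqVneq w u) rw ruv => // -> ->; rewrite eqxx.
Qed.

Lemma pushforward_indicatorB r u v :
  pushforward r (indicator u - indicator v) = indicator (r u) - indicator (r v).
Proof. by rewrite raddfB /= !pushforward_indicator. Qed.

(** When r picks component representatives, this writes a vector whose component
sums vanish as a combination of differences of connected vertices. *)
Lemma subr_pushforward r (z : {ffun V -> int}) :
  z - pushforward r z = \sum_v (indicator v - indicator (r v)) *~ z v.
Proof.
rewrite {1 2}[z]indicator_sum raddf_sum -sumrB; apply: eq_bigr => v _.
by rewrite raddfMz /= pushforward_indicator mulrzBl.
Qed.

(** The image of an idempotent pushforward consists of the vectors supported on
the fixed points of r. *)
Lemma card_ker_pushforward (C : finZmodType) r :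
  (forall v, r (r v) = r v) ->
  (#|C| ^ #|V| =
    #|C| ^ #|[set v | r v == v]| *
    #|[set z : {ffun V -> C} | pushforward r z == 0%R]|)%N.
Proof.
move=> rr; rewrite -card_ffun -cardsT.
rewrite (@card_translates V C _ (@pushforward C r) [set: _]
  [set z | pushforward r z == 0]); first last.
- by move=> x y _ _; rewrite inE raddfB subr_eq0.
- by move=> *; rewrite inE.
congr (_ * _)%N; rewrite -(card_pffun_on 0 [set v | r v == v] {: C}).
apply: eq_card => z; apply/imsetP/pffun_onP => [[y _ ->]|[zfix _]].
  split=> //; apply/fintype.subsetP=> u; rewrite !inE ffunE.
  apply: contraR => ru.
  by rewrite big1 // => v /eqP rv; move: ru; rewrite -rv rr eqxx.
exists z => //; apply/ffunP=> u; rewrite ffunE.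
have [ru|ru] := eqVneq (r u) u.
  rewrite (bigD1 u) ?ru //= big1 ?addr0 // => v /andP[/eqP rv vu].
  apply: contraNeq vu => /(fintype.subsetP zfix); rewrite inE.
  by rewrite rv eq_sym.
rewrite big1 => [|v /eqP rv]; last by move: ru; rewrite -rv rr eqxx.
by apply: contraNeq ru => /(fintype.subsetP zfix); rewrite inE.
Qed.

End Pushforward.

(** * Reduction modulo q *)

Section Residues.
Variables (q : nat) (q_gt0 : (0 < q)%N).

(** Zp1 is a generator of the additive group for every q, including q = 1,
where ['I_1] carries no ring structure. *)
Definition residue (n : int) : 'I_q.-1.+1 := Zp1 *~ n.

HB.instance Definition _ :=
  GRing.isZmodMorphism.Build int 'I_q.-1.+1 residue (mulrzBr Zp1).

Lemma residue_nat n : residue n%:Z = inZp n.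
Proof.
rewrite /residue -pmulrn Zp_mulrn.
by apply: val_inj; rewrite /= modnMml mul1n.
Qed.

Lemma residueK (c : 'I_q.-1.+1) : residue (val c)%:Z = c.
Proof. by rewrite residue_nat valZpK. Qed.

Lemma residue_eq0 n : (residue n == 0) = (q %| n)%Z.
Proof.
have natE m : (residue m%:Z == 0) = (q %| m)%N.
  by rewrite residue_nat -val_eqE /= prednK.
by rewrite -[n]/(n) dvdzE; case: n => n; rewrite ?NegzE ?raddfN ?oppr_eq0 natE.
Qed.

Variable V : finType.

Definition reduce (z : {ffun V -> int}) : {ffun V -> 'I_q.-1.+1} :=
  [ffun v => residue (z v)].

Fact reduce_is_zmod_morphism : zmod_morphism reduce.
Proof. by move=> z z'; apply/ffunP=> v; rewrite !ffunE raddfB. Qed.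

HB.instance Definition _ :=
  GRing.isZmodMorphism.Build {ffun V -> int} {ffun V -> 'I_q.-1.+1} reduce
    reduce_is_zmod_morphism.

Lemma reduce_surj w : exists z, reduce z = w.
Proof.
by exists [ffun v => (val (w v))%:Z]; apply/ffunP=> v; rewrite !ffunE residueK.
Qed.

Lemma pushforward_reduce r z :
  pushforward r (reduce z) = reduce (pushforward r z).
Proof.
apply/ffunP=> u; rewrite !ffunE raddf_sum; apply: eq_bigr => v _.
by rewrite ffunE.
Qed.

Lemma reduce_eq0 z : reduce z = 0 -> exists z', z = z' *~ q.
Proof.
move=> z0; exists [ffun v => (z v %/ q)%Z]; apply/ffunP=> v.
rewrite ffunMzE ffunE -mulrzr intz divzK //.
by rewrite -residue_eq0; move/ffunP/(_ v): z0; rewrite !ffunE => ->.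
Qed.

End Residues.

Lemma ffun_mulrz_eq0 (I : finType) (z : {ffun I -> int}) (n : nat) :
  (0 < n)%N -> z *~ n = 0 -> z = 0.
Proof.
move=> n0 /ffunP zn; apply/ffunP=> v; move: (zn v).
rewrite ffunMzE !ffunE => /eqP.
by rewrite mulrz_eq0 eqz_nat gtn_eqF //= => /eqP.
Qed.

(** * Representatives of connected components *)

Section Components.
Variable g : multigraph.
Implicit Types (S : {set edge g}) (r : vertex g -> vertex g).

Definition component_repr S r : Prop :=
  (forall v, connect (adjacent S) v (r v)) /\
  (forall u v, connect (adjacent S) u v -> r u = r v).

Lemma connect_adjacent_sym S : connect_sym (adjacent S).
Proof.
apply: sym_connect_sym => u v; apply: eq_existsb => e.
by rewrite [[set u; v]]finset.setUC.
Qed.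

Lemma connect_adjacentS S S' u v : S \subset S' ->
  connect (adjacent S) u v -> connect (adjacent S') u v.
Proof.
move=> sSS'; apply: connect_sub => {}u {}v /exists_inP[e eS uv].
by apply/connect1/exists_inP; exists e; rewrite ?(fintype.subsetP sSS').
Qed.

Lemma component_repr_root S : component_repr S (fingraph.root (adjacent S)).
Proof.
split=> [v|u v uv]; first exact: connect_root.
by apply/(fingraph.rootP (connect_adjacent_sym S)).
Qed.

Lemma component_repr_idem S r v : component_repr S r -> r (r v) = r v.
Proof. by case=> rv /(_ _ _ (rv v)). Qed.

(** Representatives for a set of edges and for a larger one need not be related;
composing them makes those of the larger set representatives for the smaller
set too. *)
Lemma component_repr_comp S S' r r' : S \subset S' ->
  component_repr S r -> component_repr S' r' ->
  component_repr S' (r \o r') /\ (r \o r') \o r =1 r \o r'.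
Proof.
move=> sSS' [rc req] [r'c r'eq]; split; last first.
  by move=> v /=; rewrite -(r'eq v) //; apply: connect_adjacentS (rc v).
split=> [v|u v uv] /=; last by rewrite (r'eq _ _ uv).
by apply: connect_trans (r'c v) (connect_adjacentS sSS' (rc _)).
Qed.

Lemma card_components S r : component_repr S r ->
  #|components S| = #|[set v | r v == v]|.
Proof.
move=> [rc req].
pose cl x := [set y in [set: vertex g] | connect (adjacent S) x y].
have -> : components S = cl @: [set v | r v == v].
  apply/setP=> B; apply/imsetP/imsetP=> -[x]; last by exists x.
  move=> _ ->; exists (r x); first by rewrite inE -(req _ _ (rc x)).
  apply/setP=> y; rewrite !inE /=; apply: same_connect (rc x) y.
  exact: connect_adjacent_sym.
apply: card_in_imset => x y; rewrite !inE => /eqP rx /eqP ry /setP/(_ y).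
by rewrite !inE /= connect0 -{2}rx -{2}ry; apply: req.
Qed.

Lemma card_componentsS S S' :
  S \subset S' -> (#|components S'| <= #|components S|)%N.
Proof.
move=> sSS'.
have hr := component_repr_root S; have hr' := component_repr_root S'.
have [hrr' _] := component_repr_comp sSS' hr hr'.
rewrite (card_components hr) (card_components hrr'); apply: subset_leq_card.
apply/fintype.subsetP => v; rewrite !inE => /eqP <- /=.
by rewrite (component_repr_idem _ hr).
Qed.

End Components.

(** * The lattice spanned by the edge vectors *)

Lemma eq_unordered_pair (T : finType) (a b c d : T) :
  a != b -> [set a; b] = [set c; d] -> (a, b) = (c, d) \/ (a, b) = (d, c).
Proof.
move=> ab /setP E; move: (E a) (E b); rewrite !inE !eqxx orbT /=.
move=> /esym/orP[]/eqP ac /esym/orP[]/eqP bd; move: ab; rewrite ac bd ?eqxx //.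
- by left.
- by right.
Qed.

Section Lattices.
Variables (g : labelled_graph) (o : edge g -> vertex g * vertex g).
Hypothesis ho : is_orientation o.
Implicit Types (S : {set edge g}) (r : vertex g -> vertex g).

Lemma orientation_neq e : (o e).1 != (o e).2.
Proof.
apply: contra_eq_neq (card_ends e) => oe; rewrite -ho oe finset.setUid cards1.
by [].
Qed.

Lemma edge_vectorE e :
  edge_vector o e = (indicator (o e).1 - indicator (o e).2) *~ label e.
Proof.
apply/ffunP=> v; rewrite ffunMzE !ffunE.
case: eqVneq => [->|_]; first by rewrite (negPf (orientation_neq e)) subr0 intz.
by case: eqVneq; rewrite ?subr0 ?mul0rz // sub0r mulNrz intz.
Qed.

Lemma pushforward_edge_vector S r e : component_repr S r -> e \in S ->
  pushforward r (edge_vector o e) = 0.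
Proof.
move=> [_ req] eS; rewrite edge_vectorE raddfMz /= pushforward_indicatorB.
rewrite (req (o e).1 (o e).2) ?subrr ?mul0rz //.
by apply/connect1/exists_inP; exists e; rewrite ?ho.
Qed.

Lemma pushforward_span S r z : component_repr S r ->
  span_of (edge_vector o) S z -> pushforward r z = 0.
Proof.
move=> hr /span_ofP[c ->]; rewrite raddf_sum big1 // => e eS.
by rewrite raddfMz /= (pushforward_edge_vector hr eS) mul0rz.
Qed.

Lemma span_indicator_ends S e u v : e \in S -> ends e = [set u; v] ->
  span_of (edge_vector o) S ((indicator u - indicator v) *~ label e).
Proof.
move=> eS euv.
have sS : subgroup (span_of (edge_vector o) S) := generated_subgroup _.
have Hx : span_of (edge_vector o) S (edge_vector o e).
  by move=> K [_]; apply; exists e.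
have := eq_unordered_pair (orientation_neq e) (etrans (ho e) euv).
case=> -[<- <-]; rewrite -?edge_vectorE // -opprB mulNrz -edge_vectorE.
exact: (subgroupN sS).
Qed.

Variables (q : nat) (q_gt0 : (0 < q)%N).
Hypothesis q_admissible : forall e : edge g, (label e %| q)%N.

(** Along a path, the difference of the end points is the sum of those of its
edges, and the label of each edge divides q. *)
Lemma span_indicator_connect S u v : connect (adjacent S) u v ->
  span_of (edge_vector o) S ((indicator u - indicator v) *~ q).
Proof.
have sS : subgroup (span_of (edge_vector o) S) := generated_subgroup _.
move=> /connectP[p]; elim: p u => [|w p IH] u /=.
  by move=> _ ->; rewrite subrr mul0rz; exact: sS.1.
move=> /andP[/exists_inP[e eS /eqP uw] /IH{}IH /IH{}IH].
rewrite -(subrK (indicator w) (indicator u)) -addrA mulrzDl.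
apply: (subgroupD sS) => //; have /dvdnP[m ->] := q_admissible e.
rewrite mulnC PoszM mulrzA; apply: (subgroupMz _ sS).
exact: span_indicator_ends.
Qed.

(** This is q L(S) <= H(S): by [subr_pushforward], the vectors of L(S) are
combinations of differences of connected vertices. *)
Lemma span_pushforward0 S r z : component_repr S r -> pushforward r z = 0 ->
  span_of (edge_vector o) S (z *~ q).
Proof.
have sS : subgroup (span_of (edge_vector o) S) := generated_subgroup _.
move=> [rc _] rz; rewrite -[z]subr0 -rz subr_pushforward mulrz_suml.
apply: (subgroup_sum sS) => v _; rewrite -mulrzA mulrC mulrzA.
by apply: (subgroupMz _ sS); apply: span_indicator_connect.
Qed.

(** A vector of L(S) divisible by q is q times a vector of L(S), as L(S) is
saturated. Hence membership in H(S) can be decided modulo q. *)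
Lemma span_reduce0 S r z : component_repr S r -> pushforward r z = 0 ->
  reduce q z = 0 -> span_of (edge_vector o) S z.
Proof.
move=> hr rz /(reduce_eq0 q_gt0)[z' zE]; rewrite zE.
apply: (span_pushforward0 hr); apply: (ffun_mulrz_eq0 q_gt0).
by rewrite -raddfMz -zE.
Qed.

End Lattices.

(** * Multiplicities *)

Definition span_reduction (g : labelled_graph)
    (o : edge g -> vertex g * vertex g) q (S : {set edge g}) :
    {set {ffun vertex g -> 'I_q.-1.+1}} :=
  [set w | `[< exists2 z, span_of (edge_vector o) S z & reduce q z = w >]].

Lemma span_reductionP g o q S w :
  reflect (exists2 z, span_of (@edge_vector g o) S z & reduce q z = w)
          (w \in span_reduction o q S).
Proof. by rewrite inE; apply: asboolP. Qed.

Section GraphGroup.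
Variables (g : labelled_graph) (o : edge g -> vertex g * vertex g).
Implicit Types (A S : {set edge g}) (r : vertex g -> vertex g).

Definition graph_proj (z : {ffun vertex g -> int}) : graph_group o :=
  (\pi_(Quotient.quot (generated_pred (dotted_vectors o))) z)%qT.

Fact graph_proj_is_zmod_morphism : zmod_morphism graph_proj.
Proof. by move=> z z'; rewrite /graph_proj raddfB. Qed.

HB.instance Definition _ :=
  GRing.isZmodMorphism.Build {ffun vertex g -> int} (graph_group o) graph_proj
    graph_proj_is_zmod_morphism.

Definition graph_lift (y : graph_group o) : {ffun vertex g -> int} :=
  repr (y : Quotient.quot (generated_pred (dotted_vectors o))).

Lemma graph_liftK y : graph_proj (graph_lift y) = y.
Proof. exact: reprK. Qed.

Lemma graph_proj_eq0 z :
  graph_proj z = 0 <-> span_of (edge_vector o) (dotted g) z.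
Proof.
rewrite -(raddf0 graph_proj).
transitivity (z - 0 \in generated_pred (dotted_vectors o)).
  by rewrite Quotient.idealrBE; split=> /eqP.
by rewrite subr0; split=> /asboolP.
Qed.

(** The quotient of the graph group by the span of A is Z^V / H(A :|: D). *)
Lemma span_graph_proj A z : A \subset regular g ->
  span_of (edge_class o) A (graph_proj z) <->
  span_of (edge_vector o) (A :|: dotted g) z.
Proof.
move=> AR; have dA : [disjoint A & dotted g].
  by rewrite finset.disjoints_subset /dotted finset.setCK.
have sumU (F : edge g -> {ffun vertex g -> int}) :
    \sum_(e in A :|: dotted g) F e =
    \sum_(e in A) F e + \sum_(e in dotted g) F e.
  by rewrite -bigU //; apply: eq_bigl => e; rewrite !inE.
split=> [/span_ofP[c zE]|/span_ofP[c ->]]; last first.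
  rewrite sumU raddfD /=.
  have /graph_proj_eq0-> : span_of (edge_vector o) (dotted g)
      (\sum_(e in dotted g) edge_vector o e *~ c e) by apply/span_ofP; exists c.
  rewrite addr0 raddf_sum; apply/span_ofP; exists c.
  by apply: eq_bigr => e _; rewrite raddfMz.
have /graph_proj_eq0/span_ofP[d dE] :
    graph_proj (z - \sum_(e in A) edge_vector o e *~ c e) = 0.
  rewrite raddfB /= zE raddf_sum -sumrB big1 // => e _.
  by rewrite raddfMz subrr.
apply/span_ofP; exists [ffun e => if e \in A then c e else d e].
rewrite sumU -[LHS](subrK (\sum_(e in A) edge_vector o e *~ c e)) dE.
rewrite addrC; congr (_ + _); apply: eq_bigr => e eA; rewrite ffunE ?eA //.
by move: eA; rewrite inE; case: ifP => // /(fintype.subsetP AR) ->.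
Qed.

Hypothesis ho : is_orientation o.
Variables (q : nat) (q_gt0 : (0 < q)%N).
Hypothesis q_admissible : forall e : edge g, (label e %| q)%N.

Variables (A : {set edge g}) (AR : A \subset regular g).
Variables (r : vertex g -> vertex g) (hr : component_repr (A :|: dotted g) r).

Let H := span_of (edge_vector o) (A :|: dotted g).

Lemma pushforward_graph_lift z :
  pushforward r (graph_lift (graph_proj z)) = pushforward r z.
Proof.
have /graph_proj_eq0/span_ofP[c e] :
    graph_proj (graph_lift (graph_proj z) - z) = 0.
  by rewrite raddfB /= graph_liftK subrr.
apply/eqP; rewrite -subr_eq0 -raddfB /= e raddf_sum big1 // => i iD.
by rewrite raddfMz /= (pushforward_edge_vector ho hr) ?mul0rz // inE iD orbT.
Qed.

Local Notation span_mod := (span_reduction o q (A :|: dotted g)).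

(* The image of L(S) in the graph group. *)
Let K : set (graph_group o) :=
  [set y | pushforward r (graph_lift y) = 0]%classic.

Definition balanced : {set {ffun vertex g -> 'I_q.-1.+1}} :=
  [set w | pushforward r w == 0].

Let coset (w : {ffun vertex g -> 'I_q.-1.+1}) :
    {set {ffun vertex g -> 'I_q.-1.+1}} :=
  [set w' : {ffun vertex g -> 'I_q.-1.+1} | w' - w \in span_mod].

Lemma span_reductionB w w' : w \in span_mod -> w' \in span_mod ->
  w - w' \in span_mod.
Proof.
move=> /span_reductionP[z Hz <-] /span_reductionP[z' Hz' <-].
apply/span_reductionP; exists (z - z'); last by rewrite raddfB.
by apply: (generated_subgroup _).2.
Qed.

Lemma coset_eq w w' : (coset w' == coset w) = (w' - w \in span_mod).
Proof.
have H0 : 0 \in span_mod.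
  apply/span_reductionP; exists 0; last by rewrite raddf0.
  exact: (generated_subgroup _).1.
apply/eqP/idP => [/setP/(_ w')|ww'].
  by rewrite inE [RHS]inE subrr H0.
have w'w : w - w' \in span_mod by rewrite -opprB -sub0r span_reductionB.
apply/setP=> u; rewrite inE [RHS]inE; apply/idP/idP => uw.
  have -> : u - w = (u - w') - (w - w') by rewrite opprB addrA subrK.
  exact: span_reductionB.
have -> : u - w' = (u - w) - (w' - w) by rewrite opprB addrA subrK.
exact: span_reductionB.
Qed.

Lemma span_reduction_balanced w : w \in span_mod -> w \in balanced.
Proof.
move=> /span_reductionP[z Hz <-].
by rewrite inE pushforward_reduce (pushforward_span ho hr Hz) raddf0.
Qed.

(** Subtracting from any lift its component sums at the representatives makes
these sums vanish and does not change the residues. *)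
Lemma balanced_lift w : w \in balanced ->
  exists2 z, pushforward r z = 0 & reduce q z = w.
Proof.
rewrite inE => /eqP w0; have [z zE] := reduce_surj w.
exists (z - pushforward r z).
  rewrite raddfB /= pushforward_comp; apply/eqP; rewrite subr_eq0; apply/eqP.
  apply/ffunP=> u; rewrite !ffunE; apply: eq_bigl => v /=.
  by rewrite (component_repr_idem _ hr).
by rewrite raddfB /= -pushforward_reduce zE w0 subr0.
Qed.

Lemma span_iff_reduction z : pushforward r z = 0 ->
  H z <-> reduce q z \in span_mod.
Proof.
move=> z0; split=> [Hz|/span_reductionP[z' Hz' z'E]].
  by apply/span_reductionP; exists z.
rewrite -(subrK z' z); apply: (subgroupD (generated_subgroup _)) => //.
apply: (span_reduce0 ho q_gt0 q_admissible hr).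
  by rewrite raddfB /= z0 (pushforward_span ho hr Hz') subrr.
by rewrite raddfB /= z'E subrr.
Qed.

Lemma subgroup_index_balanced :
  finite_index K (span_of (edge_class o) A) /\
  subgroup_index K (span_of (edge_class o) A) = #|coset @: balanced|.
Proof.
apply: (subgroup_indexE (f := fun y => coset (reduce q (graph_lift y)))).
- exact: generated_subgroup.
- by move=> y Ky; apply: imset_f; rewrite inE pushforward_reduce Ky raddf0.
- move=> _ /imsetP[w /balanced_lift[z z0 <-] ->]; exists (graph_proj z).
    by rewrite /K /= pushforward_graph_lift.
  apply/eqP; rewrite coset_eq -raddfB; apply/span_iff_reduction.
    by rewrite raddfB /= pushforward_graph_lift subrr.
  apply/span_graph_proj; rewrite // raddfB /= graph_liftK subrr.
  exact: (generated_subgroup _).1.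
move=> x y Kx Ky.
have yx0 : pushforward r (graph_lift y - graph_lift x) = 0.
  by rewrite raddfB /= Kx Ky subrr.
have yxE : span_of (edge_class o) A (y - x) <-> H (graph_lift y - graph_lift x).
  by rewrite /H -span_graph_proj // raddfB /= !graph_liftK.
rewrite yxE (span_iff_reduction yx0) raddfB /= -coset_eq.
by split=> [->|/eqP->].
Qed.

(** L(S) has finite index over H(S), and an element with a nonzero multiple in
H(S) is already in L(S). *)
Lemma max_finite_overgroup_span :
  max_finite_overgroup (span_of (edge_class o) A) = K.
Proof.
have sK : subgroup K.
  split=> [|x y Kx Ky]; rewrite /K /=.
    by rewrite -(raddf0 graph_proj) pushforward_graph_lift raddf0.
  rewrite -(graph_liftK x) -(graph_liftK y) -raddfB pushforward_graph_lift.
  by rewrite raddfB /= Kx Ky subrr.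
have K_over : finite_overgroup (span_of (edge_class o) A) K.
  split=> //; last by case: subgroup_index_balanced.
  move=> y; rewrite -{1}[y]graph_liftK => /span_graph_proj-/(_ AR).
  exact: pushforward_span.
have K_max K' : finite_overgroup (span_of (edge_class o) A) K' ->
    (K' `<=` K)%classic.
  move=> [sK' _ finK'] y K'y.
  have [n n0] := finite_index_torsion sK' (generated_subgroup _) finK' K'y.
  rewrite -[y]graph_liftK -raddfMn => /span_graph_proj-/(_ AR) yn.
  rewrite /K /= pushforward_graph_lift; apply: (ffun_mulrz_eq0 n0).
  by rewrite -raddfMz; apply: pushforward_span hr yn.
apply: xget_unique => // K' [K'_over K'_max].
by apply/seteqP; split; [apply: K_max | apply: K'_max].
Qed.

Lemma mult_balanced : #|balanced| = (mult (edge_class o) A * #|span_mod|)%N.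
Proof.
rewrite /mult max_finite_overgroup_span subgroup_index_balanced.2.
apply: card_translates => [w w' wB /span_reduction_balanced|w w' _ _];
  last exact: coset_eq.
by move: wB; rewrite !inE raddfD /= => /eqP-> /eqP->; rewrite addr0.
Qed.

End GraphGroup.

(** * Ranks *)

Section Rank.
Variables (g : labelled_graph) (o : edge g -> vertex g * vertex g).
Hypothesis ho : is_orientation o.
Variables (q : nat) (q_gt0 : (0 < q)%N).
Hypothesis q_admissible : forall e : edge g, (label e %| q)%N.
Variables (A : {set edge g}) (AR : A \subset regular g).
Variables r r' : vertex g -> vertex g.
Hypotheses (hr : component_repr (dotted g) r).
Hypotheses (hr' : component_repr (A :|: dotted g) r').
Hypothesis rr' : forall v, r (r' v) = r' v.

(* A vector supported on the fixed points of r whose pushforward along r' is 0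
   is determined by its coordinates in J: J indexes a basis of L(S) / L(D). *)
Let J := [set v | (r v == v) && (r' v != v)].
Let G := graph_group o.

Let r'r v : r' (r v) = r' v.
Proof.
apply/esym/(hr'.2); apply: connect_adjacentS (hr.1 v).
exact: finset.subsetUr.
Qed.

(* The factor q puts these vectors in H(S). *)
Let base (i : 'I_#|J|) : G :=
  graph_proj o ((indicator (enum_val i) - indicator (r' (enum_val i))) *~ q).

(** Pushing forward along r forgets L(D), and coordinate u of the image of the
u-th vector is q while the coordinate of the others is 0. *)
Lemma base_free :
  injective (fun c : {ffun 'I_#|J| -> int} => \sum_i base i *~ c i).
Proof.
move=> c d /eqP; rewrite -subr_eq0 -sumrB.
pose z := \sum_i
  (indicator (enum_val i) - indicator (r' (enum_val i))) *~ q *~ (c i - d i).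
have -> : \sum_i (base i *~ c i - base i *~ d i) = graph_proj o z.
  by rewrite raddf_sum; apply: eq_bigr => i _; rewrite -mulrzBr [RHS]raddfMz.
move=> /eqP/graph_proj_eq0/(pushforward_span ho hr) z0.
apply/ffunP=> j; apply/eqP; rewrite -subr_eq0.
have /setIdP[/eqP rj r'j] := enum_valP j.
have /ffunP/(_ (enum_val j)) := z0.
rewrite raddf_sum sum_ffunE (bigD1 j) //= big1 => [|i ij].
  rewrite !raddfMz /= pushforward_indicatorB rr' rj !ffunMzE !ffunE eqxx.
  rewrite [_ == r' _]eq_sym (negPf r'j) subr0 addr0 => /eqP.
  by rewrite !mulrz_eq0 /= eqz_nat gtn_eqF //= orbF.
have /setIdP[/eqP ri _] := enum_valP i.
rewrite !raddfMz /= pushforward_indicatorB rr' ri !ffunMzE !ffunE.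
rewrite (inj_eq enum_val_inj) eq_sym (negPf ij).
rewrite (_ : _ == r' _ = false) ?subrr ?mul0rz //.
by apply: contraNF r'j => /eqP->; rewrite (component_repr_idem _ hr').
Qed.

(** An integral relation between the coordinates in J of the pushforwards along
r gives a combination z of lifts with zero pushforward along r; then q z is in
H(D), which is a relation in the graph group. *)
Lemma free_rank_le (F : set G) s : subgroup F ->
  (F `<=` span_of (edge_class o) A)%classic -> free_abelian F s ->
  (s <= #|J|)%N.
Proof.
move=> sF FA [b [b_free FE]]; rewrite leqNgt; apply/negP => Js.
pose M : 'M[int]_(s, #|J|) :=
  \matrix_(i, j) pushforward r (graph_lift (b i)) (enum_val j).
have [u /eqP u0 uM] := int_kernel M Js.
pose z := \sum_i graph_lift (b i) *~ u 0 i.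
have projz : graph_proj o z = \sum_i b i *~ u 0 i.
  by rewrite raddf_sum; apply: eq_bigr => i _; rewrite raddfMz /= graph_liftK.
have z0 : pushforward r' z = 0.
  apply: (pushforward_span ho hr'); apply/span_graph_proj => //; apply: FA.
  rewrite FE projz; exists [ffun i => u 0 i] => //.
  by apply: eq_bigr => i _; rewrite ffunE.
have out v : r' v != v -> pushforward r z v = 0.
  move=> r'v; have [rv|rv] := eqVneq (r v) v; last first.
    rewrite ffunE big1 // => w /eqP rw.
    by move: rv; rewrite -rw (component_repr_idem _ hr) eqxx.
  have vJ : v \in J by rewrite inE rv eqxx.
  move/rowP/(_ (enum_rank_in vJ v)): uM; rewrite !mxE => <-.
  rewrite raddf_sum sum_ffunE; apply: eq_bigr => i _.
  by rewrite raddfMz /= ffunMzE mxE enum_rankK_in // -mulrzr intz mulrC.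
have rz0 : pushforward r z = 0.
  apply/ffunP=> v; rewrite [RHS]ffunE.
  have [r'v|] := eqVneq (r' v) v; last exact: out.
  transitivity (pushforward r' (pushforward r z) v).
    rewrite [RHS]ffunE (bigD1 v) ?r'v //= big1 ?addr0 //.
    move=> w /andP[/eqP <- r'w].
    by apply: out; rewrite eq_sym.
  rewrite pushforward_comp.
  transitivity (pushforward r' z v); last by rewrite z0 ffunE.
  by rewrite !ffunE; apply: eq_bigl => w; rewrite /= r'r.
have /graph_proj_eq0 := span_pushforward0 ho q_admissible hr rz0.
rewrite raddfMz /= projz => uq.
have /b_free/ffunP uq0 : \sum_i b i *~ [ffun i => u 0 i * q] i =
    \sum_i b i *~ (0 : {ffun _ -> int}) i.
  rewrite [RHS]big1 => [|i _]; last by rewrite ffunE mulr0z.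
  by rewrite -[RHS]uq mulrz_suml; apply: eq_bigr => i _; rewrite ffunE mulrzA.
apply: u0; apply/rowP=> i; have := uq0 i; rewrite !ffunE mxE => /eqP.
by rewrite mulf_eq0 eqz_nat [_ == 0%N]gtn_eqF // orbF => /eqP.
Qed.

Lemma rk_fixed_points :
  rk (edge_class o) A = (#|[set v | r v == v]| - #|[set v | r' v == v]|)%N.
Proof.
transitivity #|J|; last first.
  rewrite -cardsDS; last first.
    by apply/fintype.subsetP=> v; rewrite !inE => /eqP <-; rewrite rr'.
  by apply: eq_card => v; rewrite !inE andbC.
apply: max_free_rankE (range_comb_subgroup base) _ _ free_rank_le; last first.
  by exists base; split; first exact: base_free.
have sA : subgroup (span_of (edge_class o) A) := generated_subgroup _.
move=> _ [c _ <-]; apply: (subgroup_sum sA) => i _; apply: (subgroupMz _ sA).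
apply/span_graph_proj => //; apply: span_indicator_connect => //.
exact: hr'.1.
Qed.

End Rank.

Lemma rk_components (g : labelled_graph) (o : edge g -> vertex g * vertex g)
    (q : nat) (A : {set edge g}) :
  is_orientation o -> (0 < q)%N -> (forall e : edge g, label e %| q)%N ->
  A \subset regular g ->
  rk (edge_class o) A =
    (#|contracted_vertices g| - #|components (A :|: dotted g)|)%N.
Proof.
move=> ho q_gt0 q_adm AR.
have hr := component_repr_root (dotted g).
have [hr' _] := component_repr_comp (finset.subsetUr A _) hr
  (component_repr_root (A :|: dotted g)).
rewrite /contracted_vertices (card_components hr) (card_components hr').
apply: (rk_fixed_points ho q_gt0 q_adm AR hr hr') => v /=.
by rewrite (component_repr_idem _ hr).
Qed.

(** * Counting flows *)

Section Flows.
Variables (g : labelled_graph) (q : nat) (q_gt0 : (0 < q)%N).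
Variables (o o' : edge g -> vertex g * vertex g).
Hypotheses (ho : is_orientation o) (ho' : is_orientation o').
Hypothesis q_admissible : forall e : edge g, (label e %| q)%N.
Implicit Types S A : {set edge g}.

Definition boundary (w : {ffun edge g -> 'I_q.-1.+1}) :
    {ffun vertex g -> 'I_q.-1.+1} :=
  [ffun v => \sum_(e | (o e).1 == v) w e *+ label e
       - \sum_(e | (o e).2 == v) w e *+ label e].

Fact boundary_is_zmod_morphism : zmod_morphism boundary.
Proof.
move=> w w'; apply/ffunP=> v; rewrite !ffunE.
rewrite [in RHS]opprD [RHS]addrACA -[in RHS]opprD -!sumrB.
by congr (_ - _); apply: eq_bigr => e _; rewrite !ffunE mulrnBl.
Qed.

HB.instance Definition _ :=
  GRing.isZmodMorphism.Build {ffun edge g -> 'I_q.-1.+1}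
    {ffun vertex g -> 'I_q.-1.+1} boundary boundary_is_zmod_morphism.

Lemma boundaryE w v : boundary w v = \sum_e w e *~ edge_vector o e v.
Proof.
rewrite ffunE big_mkcond [X in _ - X]big_mkcond -sumrB; apply: eq_bigr => e _.
rewrite edge_vectorE // ffunMzE !ffunE -[X in _ *~ X]mulrzr intz.
rewrite mulrC mulrzA mulrzBr.
rewrite ![v == _]eq_sym -pmulrn.
by do 2!case: eqP; rewrite ?mulr0z ?mulr1z.
Qed.

Lemma boundary_reduce S (c : {ffun edge g -> int}) :
  boundary [ffun e => if e \in S then residue q (c e) else 0] =
  reduce q (\sum_(e in S) edge_vector o e *~ c e).
Proof.
apply/ffunP=> v; rewrite boundaryE ffunE sum_ffunE raddf_sum [RHS]big_mkcond.
apply: eq_bigr => e _; rewrite ffunE; case: ifP => _; last by rewrite mul0rz.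
by rewrite ffunMzE -mulrzr intz mulrC -raddfMz -mulrzr intz.
Qed.

Definition flows S : {set {ffun edge g -> 'I_q.-1.+1}} :=
  [set w in pffun_on 0 S {: 'I_q.-1.+1} | boundary w == 0].

Lemma pffun_on_predTP S (w : {ffun edge g -> 'I_q.-1.+1}) :
  reflect (forall e, e \notin S -> w e = 0) (w \in pffun_on 0 S {: 'I_q.-1.+1}).
Proof.
apply: (iffP pffun_onP) => [[wS _] e eS|w0].
  by apply: contraNeq eS => /(fintype.subsetP wS).
split=> //; apply/fintype.subsetP=> e; rewrite inE.
by apply: contraR => /w0->.
Qed.

(** Reversing an edge changes the sign of its vector. *)
Lemma span_of_orientation S z :
  span_of (edge_vector o) S z <-> span_of (edge_vector o') S z.
Proof.
suff sub (p p' : edge g -> vertex g * vertex g) :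
    is_orientation p -> is_orientation p' ->
    span_of (edge_vector p) S z -> span_of (edge_vector p') S z.
  by split; apply: sub.
move=> hp hp' /(_ (span_of (edge_vector p') S)); apply.
split=> [|_ [e eS <-]]; first exact: generated_subgroup.
by rewrite (edge_vectorE hp); apply: (span_indicator_ends hp' eS); rewrite hp.
Qed.

Lemma boundary_image S :
  boundary @: [set w in pffun_on 0 S {: 'I_q.-1.+1}] = span_reduction o' q S.
Proof.
apply/setP=> z; apply/imsetP/span_reductionP => [[w]|[y]].
  rewrite inE => /pffun_on_predTP wS ->.
  exists (\sum_(e in S) edge_vector o e *~ [ffun e => (val (w e))%:Z] e).
    by apply/span_of_orientation/span_ofP; exists [ffun e => (val (w e))%:Z].
  rewrite -boundary_reduce; congr boundary; apply/ffunP=> e.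
  by rewrite !ffunE residueK; case: ifPn => // /wS.
move=> /span_of_orientation/span_ofP[c ->] <-.
exists [ffun e => if e \in S then residue q (c e) else 0];
  last by rewrite boundary_reduce.
by rewrite inE; apply/pffun_on_predTP=> e /negPf eS; rewrite ffunE eS.
Qed.

Lemma card_flows_image S :
  (q ^ #|S| = #|span_reduction o' q S| * #|flows S|)%N.
Proof.
rewrite -boundary_image; pose P := [set w in pffun_on 0 S {: 'I_q.-1.+1}].
have -> : (q ^ #|S|)%N = #|P| by rewrite cardsE card_pffun_on card_ord prednK.
have -> : flows S = [set w in P | boundary w == 0].
  by apply/setP=> w; rewrite !inE.
have PB : {in P &, forall w w', w - w' \in P}.
  move=> w w'; rewrite ![_ \in P]inE.
  move=> /pffun_on_predTP wS /pffun_on_predTP w'S.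
  by apply/pffun_on_predTP => e eS; rewrite !ffunE wS // w'S // subrr.
apply: card_translates => [w w' wP /setIdP[w'P _]|w w' wP w'P].
  by rewrite -[w']opprK PB // -sub0r PB // -(subrr w) PB.
by rewrite inE PB // raddfB subr_eq0.
Qed.

(** Multiply #|balanced| = m(A) * #|span_reduction| by the number of flows: the
left factor is q^(|V| - c(S)), and the product of the last two is q^|S|. *)
Lemma card_flows A : A \subset regular g ->
  (#|flows (A :|: dotted g)| * q ^ #|vertex g| =
   q ^ #|A :|: dotted g| * q ^ #|components (A :|: dotted g)| *
   mult (edge_class o') A)%N.
Proof.
move=> AR; have hr := component_repr_root (A :|: dotted g).
rewrite (card_components hr) card_flows_image.
have := @card_ker_pushforward _ 'I_q.-1.+1 _
  (fun v => component_repr_idem v hr).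
have -> : #|'I_q.-1.+1| = q by rewrite card_ord prednK.
move=> ->.
rewrite (mult_balanced ho' q_gt0 q_admissible AR hr).
ring.
Qed.

Lemma nb_nz_flowsE : nb_nz_flows o q =
  #|[set w in flows [set: edge g] | [forall e in regular g, w e != 0]]|.
Proof.
apply: eq_card => w; rewrite inE [RHS]inE /is_nz_flow; congr andb.
rewrite /flows inE; have -> : w \in pffun_on 0 [set: edge g] {: 'I_q.-1.+1}.
  by apply/pffun_on_predTP => e; rewrite inE.
apply/forallP/eqP => [w0|/ffunP w0 v].
  by apply/ffunP=> v; rewrite !ffunE; apply/eqP.
by have := w0 v; rewrite !ffunE => ->.
Qed.

Lemma flows_vanishing A : A \subset regular g ->
  [set w in flows [set: edge g] | [forall e in regular g :\: A, w e == 0]] =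
  flows (A :|: dotted g).
Proof.
move=> AR; apply/setP=> w; rewrite inE /flows inE [RHS]inE andbAC; congr andb.
apply/andP/pffun_on_predTP => [[_ /forall_inP w0] e eS|w0].
  by apply/eqP/w0; move: eS; rewrite !inE negb_or negbK.
split; first by apply/pffun_on_predTP => e; rewrite inE.
apply/forall_inP=> e eRA; apply/eqP/w0.
by move: eRA; rewrite !inE negb_or negbK.
Qed.

End Flows.

(** * Inclusion-exclusion and the final evaluation *)

Lemma prod_natr_bool (I : finType) (S : {set I}) (b : pred I) :
  \prod_(i in S) (b i)%:R = [forall i in S, b i]%:R :> int.
Proof.
case: forall_inP => [bS|nbS]; first by rewrite big1 // => i /bS->.
have [i iS /negPf bi] : exists2 i, i \in S & ~~ b i.
  apply/exists_inP; apply: contra_notT nbS => /exists_inPn nb i /nb.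
  by rewrite negbK.
by rewrite (bigD1 i) //= bi mul0r.
Qed.

(** For each w, expand the product over e in R of 1 - [Z w e]. As a product over
I, its factor at e is [e \in R] plus either - [Z w e] or, outside R, 1; so only
the subsets A of R contribute to the expansion. *)
Lemma sieve (T I : finType) (P : {set T}) (Z : T -> pred I) (R : {set I}) :
  #|[set w in P | [forall e in R, ~~ Z w e]]|%:R =
  \sum_(A : {set I} | A \subset R) (-1) ^+ (#|R| - #|A|) *
    #|[set w in P | [forall e in R :\: A, Z w e]]|%:R :> int.
Proof.
have cardE (Q : pred T) :
    #|[set w in P | Q w]|%:R = \sum_(w in P) (Q w)%:R :> int.
  rewrite -sum1_card natr_sum big_mkcond [RHS]big_mkcond /=.
  by apply: eq_bigr => w _; rewrite inE; case: (w \in P) (Q w) => -[].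
rewrite cardE; under [RHS]eq_bigr do rewrite cardE mulr_sumr.
rewrite exchange_big; apply: eq_bigr => w _ /=.
rewrite -prod_natr_bool.
transitivity
  (\prod_e ((e \in R)%:R + if e \in R then - (Z w e)%:R else 1 : int)).
  rewrite big_mkcond; apply: eq_bigr => e _; case: ifP => _;
    last by rewrite add0r.
  by case: (Z w e).
rewrite bigA_distr [RHS]big_mkcond; apply: eq_bigr => A _.
case: ifPn => [AR|/subsetPn[e eA eR]]; last first.
  by rewrite (bigD1 e) //= eA (negPf eR) mul0r.
rewrite -prod_natr_bool -cardsDS // -prodrN [RHS]big_mkcond.
apply: eq_bigr => e _.
by rewrite inE; case: ifP => [/(fintype.subsetP AR)->|_].
Qed.

Lemma arith_tutte_eval (G : zmodType) (I : finType) (x : I -> G) (R : {set I})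
    (a b : int) :
  (arith_tutte x R).[a, b] =
  \sum_(A : {set I} | A \subset R)
    (mult x A)%:R * (a - 1) ^+ (rk x R - rk x A) * (b - 1) ^+ (#|A| - rk x A).
Proof.
rewrite /arith_tutte !horner_sum; apply: eq_bigr => A _.
by rewrite !(hornerM, horner_exp, hornerMn, hornerD, hornerN, hornerX, hornerC).
Qed.

(** Here a, d, r, n are the numbers of edges in A, D, R and of vertices, and k,
cA, cD the numbers of components for R :|: D, A :|: D and D. The exponents of Q
agree; those of -1 differ by 2 (cD - cA - a). *)
Lemma flow_term_eq (F : fieldType) (Q N m : F) (a d r n cD cA k : nat) :
  Q != 0 -> (cA <= cD)%N -> (k <= cA)%N -> (a <= r)%N -> (cD - cA <= a)%N ->
  N * Q ^+ n = Q ^+ (a + d) * Q ^+ cA * m ->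
  (-1) ^+ (r - a) * N =
  (-1) ^ (r%:Z - cD%:Z + k%:Z) * Q ^ (d%:Z - n%:Z + cD%:Z) *
    (m * (-1) ^+ ((cD - k) - (cD - cA)) * (- Q) ^+ (a - (cD - cA))).
Proof.
move=> Q0 cAD kA ar cDa Nn.
have N1 : (-1 : F) != 0 by rewrite oppr_eq0 oner_eq0.
have -> : N = Q ^ ((a + d + cA)%:Z - n%:Z) * m.
  apply: (mulIf (expf_neq0 n Q0)); rewrite Nn -exprD expfzDr //.
  by rewrite -exprnN mulrAC -exprnP divfK // expf_neq0.
have even_sign z : (-1 : F) ^ (2 * z) = 1.
  by rewrite -exprz_exp -exprnP sqrrN expr1n exp1rz.
rewrite -[- Q]mulN1r exprMn !exprnP.
rewrite (_ : (a + d + cA)%:Z - n%:Z =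
  (d%:Z - n%:Z + cD%:Z) + (a - (cD - cA))%N%:Z); last lia.
rewrite expfzDr // (_ : ((r - a)%N : int) = (r%:Z - cD%:Z + k%:Z) +
  (cD - k - (cD - cA))%N%:Z + (a - (cD - cA))%N%:Z +
  2 * (cD%:Z - cA%:Z - a%:Z)); last lia.
rewrite 3!(expfzDr _ _ N1) even_sign.
ring.
Qed.

Theorem theorem5p2
  (g : labelled_graph) (k : nat)
  (hk : #|components [set: edge g]| = k)
  (q : nat) (q_gt0 : (0 < q)%N)
  (q_admissible : forall e : edge g, (label e %| q)%N)
  (o : edge g -> vertex g * vertex g) (ho : is_orientation o)
  (o' : edge g -> vertex g * vertex g) (ho' : is_orientation o') :
  (nb_nz_flows o q)%:R =
    (-1) ^ (#|regular g|%:Z - #|contracted_vertices g|%:Z + k%:Z)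
    * q%:R ^ (#|dotted g|%:Z - #|vertex g|%:Z + #|contracted_vertices g|%:Z)
    * ((graph_arith_tutte o').[0, 1 - q%:Z])%:~R :> rat.
Proof.
have RD : regular g :|: dotted g = [set: edge g] by rewrite finset.setUCr.
rewrite nb_nz_flowsE -[LHS]mulrz_nat (sieve (flows q o [set: edge g])
  (fun w e => w e == 0)).
rewrite /graph_arith_tutte arith_tutte_eval !raddf_sum mulr_sumr /=.
apply: eq_bigr => A AR; rewrite flows_vanishing //.
rewrite !(rk_components ho' q_gt0 q_admissible) // RD hk.
have -> : 1 - q%:Z - 1 = - q%:Z by lia.
rewrite sub0r !rmorphM !rmorphXn !rmorphN !rmorph1 !rmorph_nat /= -pmulrn.
apply: flow_term_eq;
  rewrite -?hk ?card_componentsS ?subset_leq_card ?finset.subsetT //.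
- by rewrite pnatr_eq0 -lt0n.
- exact: finset.subsetUr.
- rewrite -(rk_components ho' q_gt0 q_admissible) //; exact: rk_le_card.
have := card_flows q_gt0 ho ho' q_admissible AR.
rewrite (_ : #|A :|: dotted g| = #|A| + #|dotted g|)%N; last first.
  have dA : [disjoint A & dotted g].
    by rewrite finset.disjoints_subset /dotted finset.setCK.
  by apply/eqP; rewrite (leq_card_setU A (dotted g)).2.
by move/(congr1 (fun n => n%:R : rat)); rewrite !natrM !natrX.
Qed.
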